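(* Let $r\ge 3$ be an integer and let $\chi$ be an $r$-coloring of $\mathbb{Z}^2$. Then at least one of the following holds: (i) there is a rainbow triangle of area $1/2$ with vertices in $\mathbb{Z}^2$; (ii) for every positive even integer $A$ there is a monochromatic rectangle of area $A$ with vertices in $\mathbb{Z}^2$ whose sides are parallel to the coordinate axes.
   Context: An $r$-coloring of a set $X$ is an assignment of colors to the elements of $X$ in which exactly $r$ colors occur. Only vertex colors are considered: a triangle (resp. rectangle) is identified with the set of its three (resp. four) vertices, figures being non-degenerate. A figure is monochromatic if all its vertices have the same color. A subset $Y\subset X$ is rainbow under a coloring $\chi$ of $X$ if $|\chi(Y)|=\min\{|\chi(X)|,|Y|\}$; since at least three colors occur here, a rainbow triangle is one whose three vertices have pairwise distinct colors. *)

(* Defs.v *)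
From HB Require Import structures.
From mathcomp Require Import all_boot all_order all_algebra finmap.
From mathcomp Require Import boolp classical_sets functions cardinality.

Set Implicit Arguments.
Unset Strict Implicit.
Unset Printing Implicit Defensive.

Import Order.TTheory GRing.Theory Num.Theory.

Local Open Scope card_scope.
Local Open Scope classical_set_scope.
Local Open Scope ring_scope.

Section Coloring.
Variables (X C : choiceType) (chi : X -> C).

(* The type C may contain colors that are not used. *)
Definition coloring (r : nat) : Prop := range chi #= `I_r.

Definition monochromatic (Y : {fset X}) : Prop :=
  forall x y, x \in Y -> y \in Y -> chi x = chi y.

(* |chi(Y)| = min(|chi(X)|, |Y|); fset_set is meaningful only on finite sets,
   so this is intended for a chi that takes finitely many values. *)
Definition rainbow (Y : {fset X}) : Prop :=
  #|` [fset chi y | y in Y]%fset| = minn #|` fset_set (range chi)| #|` Y|.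

End Coloring.

Notation Z2 := (int * int)%type.

Definition triangle (p q s : Z2) : {fset Z2} := [fset p; q; s]%fset.

Definition triangle_area (p q s : Z2) : rat :=
  `|(q.1 - p.1) * (s.2 - p.2) - (s.1 - p.1) * (q.2 - p.2)|%:~R / 2.

(* The axis-parallel rectangle [x1, x2] x [y1, y2]; it is non-degenerate when
   x1 < x2 and y1 < y2. *)
Definition rectangle (x1 x2 y1 y2 : int) : {fset Z2} :=
  [fset (x1, y1); (x2, y1); (x2, y2); (x1, y2)]%fset.

Definition rectangle_area (x1 x2 y1 y2 : int) : int := (x2 - x1) * (y2 - y1).

(* Main.v *)
Require Import Defs.
From HB Require Import structures.
From mathcomp Require Import all_boot all_order all_algebra finmap.
From mathcomp Require Import boolp classical_sets functions cardinality.
From mathcomp Require Import zify ring.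

(** Suppose that no triangle of area 1/2 is rainbow.  Then the third vertex of
    such a triangle repeats one of the colors of the other two as soon as these
    differ ([rainbow_free]), so a two-colored pair at difference (1, 0) forces
    its two colors on the rows just above and below.  If no row were
    monochromatic, these two colors would spread to the whole plane; hence some
    row y0 has a single color b ([monochromatic_row]).

    Call an edge a pair of points whose difference has coprime coordinates.
    The color b dominates: two other colors never meet along an edge ([star]).
    Indeed an edge uv whose ends have different colors forces these two colors
    on the lattice lines parallel to uv next to it.  If uv has height 1, such a
    line meets row y0, so b would be one of the two colors; any other edge is
    the third side of a triangle of area 1/2 with two lower sides, or, if it is
    horizontal, with two sides of height 1.

    Now let A be even, and suppose that no rectangle of width A and height 1
    with one side on row y0 is monochromatic.  On each of the rows y0 + 1 and
    y0 - 1, one of x and x + A then has a color other than b.  As A is even,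
    this gives enough edges between points of color other than b to connect all
    of these points ([at_most_two_colors]): only one color besides b is left,
    which contradicts the presence of three colors. *)

Set Implicit Arguments.
Unset Strict Implicit.
Unset Printing Implicit Defensive.

Import Order.TTheory GRing.Theory Num.Theory.

Local Open Scope ring_scope.

Lemma int_step_ind (P : int -> Prop) (m : int) :
  P m -> (forall n, P n -> P (n + 1)) -> (forall n, P n -> P (n - 1)) ->
  forall n, P n.
Proof.
move=> Pm Pup Pdown n; have -> : n = m + (n - m) by ring.
elim/int_ind: (n - m) => [|k IHk|k IHk]; first by rewrite addr0.
  by rewrite -addn1 PoszD addrA; apply: Pup.
by rewrite -addn1 PoszD opprD addrA; apply: Pdown.
Qed.

Lemma coprimez_det (a b c d : int) : `|a * d - b * c| = 1 -> coprimez a b.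
Proof.
move=> det; apply/coprimezP.
have [e|e] : a * d - b * c = 1 \/ a * d - b * c = -1 by lia.
  by exists (d, - c) => /=; rewrite -e; ring.
by exists (- d, c) => /=; rewrite -[RHS]opprK -e; ring.
Qed.

(** Modulo a prime p dividing K, n must avoid the classes 0 and -A.  These
    leave some class free, even for p = 2, because A is even.  With L the
    largest divisor of K coprime to A, n = A + L works for all p at once: n
    and n + A are both L modulo the p dividing A, and they are A and 2A modulo
    the others. *)
Lemma coprime_shift (A K : nat) :
  (0 < A)%N -> ~~ odd A -> (0 < K)%N ->
  exists n : nat, coprime n K /\ coprime (n + A) K.
Proof.
move=> A0 Aev K0; pose L := (K`_(\pi(A)^'))%N.
have cAL : coprime A L.
  by rewrite -{1}(part_pnat_id (pnat_pi A0)) coprime_partC.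
have cp (m : nat) : coprime (m * A) L -> coprime (m * A + L) K.
  move=> cmL; rewrite -(partnC \pi(A) K0) coprimeMr -/L.
  rewrite [X in _ && X]coprime_sym [X in _ && X]/coprime gcdnDr.
  rewrite [X in _ && X]coprime_sym cmL andbT coprime_sym.
  apply: (@pnat_coprime \pi(A)); first exact: part_pnat.
  apply/pnatP => [|p pp pd]; first by rewrite addn_gt0 part_gt0 orbT.
  rewrite !inE /= mem_primes pp A0 /=; apply/negP => pA.
  have pL : (p %| L)%N by rewrite -(dvdn_addr _ (dvdn_mull m pA)).
  have : (p %| gcdn A L)%N by rewrite dvdn_gcd pA.
  by rewrite (eqP cAL) Euclid_dvd1.
exists (1 * A + L)%N; split; first by apply: cp; rewrite mul1n.
have -> : (1 * A + L + A = 2 * A + L)%N by lia.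
apply: cp; rewrite coprimeMl cAL andbT coprime2n.
rewrite -[odd L]negbK -dvdn2; apply/negP => L2.
have : (2 %| gcdn A L)%N by rewrite dvdn_gcd dvdn2 Aev.
by rewrite (eqP cAL).
Qed.

Lemma coprimez_shift (A : nat) (K : int) :
  (0 < A)%N -> ~~ odd A -> K != 0 ->
  exists n : int, coprimez n K /\ coprimez (n + A%:Z) K.
Proof.
move=> A0 Aev K0; have [|n [c1 c2]] := @coprime_shift A `|K|%N A0 Aev.
  by rewrite absz_gt0.
by exists n%:Z; rewrite !coprimezE.
Qed.

(** Twice the signed area of the triangle. *)
Definition orient (p q s : Z2) : int :=
  (q.1 - p.1) * (s.2 - p.2) - (s.1 - p.1) * (q.2 - p.2).

(** Points with [`|orient p q s| = 1] are the vertices of a triangle of area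
    1/2.  The absence of rainbow ones is put in the form in which it propagates
    two colors. *)
Definition rainbow_free (C : eqType) (chi : Z2 -> C) : Prop :=
  forall p q s, `|orient p q s| = 1 ->
    chi p != chi q -> chi s \in [:: chi p; chi q].

Lemma card_fset_range (X C : choiceType) (chi : X -> C) (r : nat) :
  coloring chi r -> #|` fset_set (range chi)| = r.
Proof. by move=> /card_fset_set. Qed.

Lemma rainbow_freeP (C : choiceType) (r : nat) (chi : Z2 -> C) :
  (3 <= r)%N -> coloring chi r ->
  ~ (exists p q s : Z2,
     triangle_area p q s = 1 / 2 /\ rainbow chi (triangle p q s)) ->
  rainbow_free chi.
Proof.
move=> r3 col nor p q s pqs1 pq; rewrite !inE; apply/negPn/negP.
rewrite negb_or => /andP[sp sq]; apply: nor; exists p, q, s; split.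
  by rewrite /triangle_area -/(orient p q s) pqs1.
have img : [fset chi y | y in triangle p q s]%fset
         = [fset chi p; chi q; chi s]%fset.
  apply/fsetP => c; apply/imfsetP/idP => [[y]|].
    by rewrite !inE => /orP[/orP[]|] /eqP -> ->; rewrite eqxx ?orbT.
  by rewrite !inE => /orP[/orP[]|] /eqP ->; [exists p|exists q|exists s];
     rewrite // !inE eqxx ?orbT.
have card3 (T : choiceType) (x y z : T) :
    x != y -> z != x -> z != y -> #|` [fset x; y; z]%fset| = 3%N.
  move=> xy zx zy; rewrite fsetUC cardfsU1 cardfs2 xy !inE.
  by rewrite (negPf zx) (negPf zy).
have neq (x y : Z2) : chi x != chi y -> x != y.
  by apply: contraNneq => ->.
rewrite /rainbow img (card_fset_range col) !card3 ?neq //.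
by symmetry; apply/minn_idPr.
Qed.

Lemma third_color (X C : choiceType) (r : nat) (chi : X -> C) :
  (3 <= r)%N -> coloring chi r ->
  forall d e, exists x, chi x \notin [:: d; e].
Proof.
move=> r3 col d e; apply: contrapT => no.
have : (#|` fset_set (range chi)| <= #|` [fset d; e]%fset|)%N.
  apply: fsubset_leq_card; apply/fsubsetP => c.
  have fin : finite_set (range chi) by exists r.
  rewrite in_fset_set // => /set_mem [x _ <-].
  rewrite !inE; have: chi x \in [:: d; e]; last by rewrite !inE.
  by apply/negPn/negP => xde; apply: no; exists x.
rewrite (card_fset_range col) cardfs2 => /(leq_trans r3).
by case: (_ != _).
Qed.

(** Otherwise every row has two consecutive points of different colors.  Each of
    the two adjacent rows makes a triangle of area 1/2 with them, so it uses only
    their two colors.  Starting from one such pair, two colors fill the plane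
    row by row. *)
Lemma monochromatic_row (C : eqType) (chi : Z2 -> C) :
  rainbow_free chi ->
  (forall d e, exists p, chi p \notin [:: d; e]) ->
  exists y b, forall x, chi (x, y) = b.
Proof.
move=> free three; apply: contrapT => nomono.
have step y : exists x, chi (x, y) != chi (x + 1, y).
  apply: contrapT => no; apply: nomono; exists y, (chi (0, y)).
  have eq1 x : chi (x, y) = chi (x + 1, y).
    by apply/eqP/negPn/negP => ne; apply: no; exists x.
  apply: (@int_step_ind _ 0) => // x <-; first by rewrite -eq1.
  by rewrite eq1 subrK.
have spread x y z y' : chi (x, y) != chi (x + 1, y) ->
    (y' = y + 1) \/ (y' = y - 1) ->
    chi (z, y') \in [:: chi (x, y); chi (x + 1, y)].
  move=> ne yy'; apply: free => //.
  have -> : orient (x, y) (x + 1, y) (z, y') = y' - y.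
    by rewrite /orient /=; ring.
  by case: yy' => ->; rewrite addrAC subrr add0r ?normrN1.
(* The induction starts at row 1: row 0 itself is not yet known to be
   two-colored. *)
have [x0 ne0] := step 0.
pose d := chi (x0, 0); pose e := chi (x0 + 1, 0).
have all_y : forall y z, chi (z, y) \in [:: d; e].
  have nxt y y' : (y' = y + 1) \/ (y' = y - 1) ->
      (forall z, chi (z, y) \in [:: d; e]) ->
      forall z, chi (z, y') \in [:: d; e].
    move=> yy' IH z; have [x ne] := step y; have := spread x y z y' ne yy'.
    by rewrite !inE => /orP[] /eqP ->; have := IH x; have := IH (x + 1);
       rewrite !inE.
  apply: (@int_step_ind _ 1) => [z|y|y].
  - by apply: spread => //; left.
  - by apply: nxt; left.
  - by apply: nxt; right.
by have [[x y]] := three d e; rewrite all_y.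
Qed.

(** The vector (x, y) completes (s, t) to a basis of the lattice, so that it and
    (s, t) - (x, y) are the two other sides of a triangle of area 1/2 on (s, t).
    Both are lower than (s, t), or of height 1: y, an inverse of s modulo t, is
    taken between 0 and t. *)
Lemma intermediate_vector (s t : int) : coprimez s t ->
  exists x y : int, [/\ `|s * y - x * t| = 1,
    (`|y| < `|t|) || (`|y| == 1) & (`|t - y| < `|t|) || (`|t - y| == 1)].
Proof.
move=> st.
have [t0|t0] := eqVneq t 0.
  move: st; rewrite t0 coprimezE /coprime gcdn0 => /eqP s1.
  by exists 0, 1; rewrite mulr1 mul0r subr0; split => //; lia.
have /coprimezP[[a b] /= ab] := st.
have [y [k [yE y0 y1]]] : exists y k : int,
    [/\ a = k * t + y, 0 <= y * t & `|y| < `|t|].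
  have yge := modz_ge0 a t0; have ylt := ltz_mod a t0.
  have aE := divz_eq a t.
  (* The remainder modulo t is nonnegative; for t < 0, subtracting |t| brings
     it between t and 0. *)
  have [tp|tn] := ltrP 0 t.
    by exists (a %% t)%Z, (a %/ t)%Z; split => //; [nia | lia].
  have [y0|y0] := eqVneq (a %% t)%Z 0.
    by exists 0, (a %/ t)%Z; rewrite mul0r; split => //; lia.
  exists ((a %% t)%Z + t), ((a %/ t)%Z - 1); split.
  - by rewrite [LHS]aE; ring.
  - nia.
  - lia.
have det : s * y - (- (b + k * s)) * t = 1 by rewrite -ab yE; ring.
exists (- (b + k * s)), y; split; first by rewrite det.
  by rewrite y1.
have [y00|y00] := eqVneq y 0; last by apply/orP; left; nia.
apply/orP; right; rewrite y00 subr0.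
have : (t %| 1%R)%Z by rewrite -det y00 mulr0 sub0r -mulNr dvdz_mull.
by rewrite dvdz1; lia.
Qed.

(** A line of direction (s, 1) or (s, -1) meets every row, in particular the
    monochromatic one.  Applied to a line next to uv, this gives a triangle of
    area 1/2 whose third vertex has color b. *)
Lemma star_height1 (C : eqType) (chi : Z2 -> C) (y0 : int) (b : C)
    (u v : Z2) :
  rainbow_free chi -> (forall x, chi (x, y0) = b) ->
  `|v.2 - u.2| = 1 -> chi u != b -> chi v != b -> chi u = chi v.
Proof.
move=> free row h1 ub vb; apply/eqP/negPn/negP => uv.
pose s := v.1 - u.1; pose t := v.2 - u.2.
(* As t^2 = 1, this is the solution on row y0 of orient u v w = 1. *)
pose w : Z2 := (u.1 + t * (s * (y0 - u.2) - 1), y0).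
have w1 : `|orient u v w| = 1.
  have tt : t * t = 1 by rewrite /t; lia.
  rewrite /orient /= -/s -/t.
  have -> : s * (y0 - u.2) - (u.1 + t * (s * (y0 - u.2) - 1) - u.1) * t
    = s * (y0 - u.2) - (t * t) * (s * (y0 - u.2) - 1) by ring.
  by rewrite tt mul1r opprB addrCA subrr addr0.
have := free _ _ _ w1 uv.
by rewrite /w row !inE ![b == _]eq_sym (negPf ub) (negPf vb).
Qed.

(** By induction on the height of the edge: the intermediate point w has one of
    the colors of u and v if these differ, hence not b, and comparing w with u
    and with v along the edges wu and wv, lower or of height 1, shows that u and
    v agree after all. *)
Lemma star (C : eqType) (chi : Z2 -> C) (y0 : int) (b : C) (u v : Z2) :
  rainbow_free chi -> (forall x, chi (x, y0) = b) ->
  coprimez (v.1 - u.1) (v.2 - u.2) -> chi u != b -> chi v != b ->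
  chi u = chi v.
Proof.
move=> free row; have [n] := ubnP (absz (v.2 - u.2)).
elim: n u v => // n IH u v hn cop ub vb.
apply/eqP/negPn/negP => uv.
have [x [y [xy1 y_lt y'_lt]]] := intermediate_vector cop.
pose a := v.1 - u.1; pose c := v.2 - u.2; pose w : Z2 := (u.1 + x, u.2 + y).
have w1 : `|orient u v w| = 1.
  by rewrite /orient /= !(addrC _ x) !(addrC _ y) !addrK.
have wb : chi w != b by have := free _ _ _ w1 uv; rewrite !inE => /orP[] /eqP ->.
have cuw : chi u = chi w.
  case/orP: y_lt => h; last by apply: (star_height1 free row) => //=; lia.
  apply: IH => //=; first by lia.
  apply: (@coprimez_det _ _ a c); rewrite distrC -xy1.
  by congr `|_|; rewrite -/a -/c; ring.
have cwv : chi w = chi v.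
  case/orP: y'_lt => h; last by apply: (star_height1 free row) => //=; lia.
  apply: IH => //=; first by lia.
  apply: (@coprimez_det _ _ x y); rewrite -xy1.
  by congr `|_|; rewrite /w /=; ring.
by rewrite cuw cwv eqxx in uv.
Qed.

(** If P never held at two consecutive places, P x would exclude x + 1, hence
    give x + 1 + A, hence exclude x + 2 + A, and hence give x + 2.  After A / 2
    rounds P holds at x + A as well as at x + 1 + A. *)
Lemma adjacent_pair (A : nat) (P : int -> bool) :
  ~~ odd A ->
  (forall x, P x || P (x + A%:Z)) -> exists x, P x && P (x + 1).
Proof.
move=> Aev alt; apply: contrapT => no.
have sep x : P x -> ~~ P (x + 1).
  by move=> Px; apply/negP => Px1; apply: no; exists x; rewrite Px.
have jump x : P x -> P (x + 1 + A%:Z).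
  by move=> /sep Px1; have := alt (x + 1); rewrite (negPf Px1).
have step x : P x -> P (x + 2%:Z).
  move=> /jump /sep Px2; have := alt (x + 2%:Z).
  have -> : x + 2%:Z + A%:Z = x + 1 + A%:Z + 1 by lia.
  by rewrite (negPf Px2) orbF.
have steps k x : P x -> P (x + (k * 2)%N%:Z).
  elim: k => [|k IH] Px; first by rewrite addr0.
  have -> : x + (k.+1 * 2)%N%:Z = x + (k * 2)%N%:Z + 2%:Z by lia.
  exact/step/IH.
have [x Px] : exists x, P x.
  by have /orP[] := alt 0; [exists 0|exists (0 + A%:Z)].
have := sep _ (steps A./2 x Px); rewrite muln2 even_halfK //.
have -> : x + A%:Z + 1 = x + 1 + A%:Z by lia.
by rewrite jump.
Qed.

(** Row y0 + 1 first: its points of color other than b in one parity class share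
    their color, through a common neighbor on row y0 - 1, and two consecutive
    ones tie the two classes together.  Any other point of color other than b is
    joined by an edge to one of the two points x, x + A of row y0 + 1, for a
    suitable x given by [coprime_shift]. *)
Lemma at_most_two_colors (C : eqType) (chi : Z2 -> C) (y0 : int) (b : C)
    (A : nat) :
  (0 < A)%N -> ~~ odd A ->
  (forall u v : Z2, coprimez (v.1 - u.1) (v.2 - u.2) ->
     chi u != b -> chi v != b -> chi u = chi v) ->
  (forall x e, `|e| = 1 ->
     (chi (x, y0 + e) != b) || (chi (x + A%:Z, y0 + e) != b)) ->
  exists c, forall p, chi p \in [:: b; c].
Proof.
move=> A0 Aev star_b alt.
have upper x := alt x 1 erefl.
have [x1 /andP[x1b x1b']] := adjacent_pair Aev upper.
pose c := chi (x1, y0 + 1).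
have parity x x' : chi (x, y0 + 1) != b -> chi (x', y0 + 1) != b ->
    (2 %| x' - x)%Z -> chi (x, y0 + 1) = chi (x', y0 + 1).
  move=> xb x'b xx'.
  have [z [zb xz]] : exists z, chi (z, y0 - 1) != b /\ ~~ (2 %| z - x)%Z.
    have /orP[zb|zb] := alt (x + 1) (-1) erefl.
      by exists (x + 1); split => //; lia.
    by exists (x + 1 + A%:Z); split => //; lia.
  have to_z w : chi (w, y0 + 1) != b -> ~~ (2 %| z - w)%Z ->
      chi (w, y0 + 1) = chi (z, y0 - 1).
    move=> wb wz; apply: star_b => //=.
    by apply: (@coprimez_det _ _ (- ((z - w) %/ 2)%Z) 1); lia.
  by rewrite (to_z x) // (to_z x') //; lia.
have upper_c x : chi (x, y0 + 1) != b -> chi (x, y0 + 1) = c.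
  move=> xb.
  have [d|d] : (2 %| x - x1)%Z \/ (2 %| x - (x1 + 1))%Z by lia.
    by symmetry; apply: parity.
  rewrite -(parity _ _ x1b' xb d); symmetry; apply: star_b => //=.
  by apply: (@coprimez_det _ _ 0 1); lia.
exists c => -[z k]; rewrite !inE; have [//|zb /=] := eqVneq (chi (z, k)) b.
have [k1|k1] := eqVneq k (y0 + 1); first by rewrite k1 upper_c // -k1.
have K0 : k - (y0 + 1) != 0 by rewrite subr_eq0.
have [n [n1 n2]] := coprimez_shift A0 Aev K0.
have near x : chi (x, y0 + 1) != b -> coprimez (z - x) (k - (y0 + 1)) ->
    chi (z, k) == c.
  by move=> xb cop; rewrite -(star_b (x, y0 + 1) (z, k)) // upper_c.
have /orP[xb|xb] := upper (z - n - A%:Z).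
  by apply: (near _ xb); have -> : z - (z - n - A%:Z) = n + A%:Z by ring.
move: xb; rewrite subrK => xb.
by apply: (near _ xb); have -> : z - (z - n) = n by ring.
Qed.

Theorem theorem2 (C : choiceType) (r : nat) (chi : Z2 -> C) :
  (3 <= r)%N -> coloring chi r ->
  (exists p q s : Z2,
     triangle_area p q s = 1 / 2 /\ rainbow chi (triangle p q s)) \/
  (forall A : nat, (0 < A)%N -> ~~ odd A ->
     exists x1 x2 y1 y2 : int,
       [/\ x1 < x2, y1 < y2, rectangle_area x1 x2 y1 y2 = A%:Z
         & monochromatic chi (rectangle x1 x2 y1 y2)]).
Proof.
move=> r3 col.
have [|/(rainbow_freeP r3 col) free] := EM (exists p q s : Z2,
  triangle_area p q s = 1 / 2 /\ rainbow chi (triangle p q s)); first by left.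
right=> A A0 Aev.
have three := third_color r3 col.
have [y0 [b row]] := monochromatic_row free three.
apply: contrapT => norect.
have mono x e y : `|e| = 1 -> y = Num.min y0 (y0 + e) ->
    chi (x, y0 + e) = b -> chi (x + A%:Z, y0 + e) = b -> False.
  move=> e1 yE c1 c2; apply: norect; exists x, (x + A%:Z), y, (y + 1); split.
  - lia.
  - lia.
  - by rewrite /rectangle_area; ring.
  - have all_b p : p \in rectangle x (x + A%:Z) y (y + 1) -> chi p = b.
      have [ee|ee] : e = 1 \/ e = -1 by lia.
        have yy : y = y0 by lia.
        by rewrite !inE => /orP[/orP[/orP[]|]|] /eqP ->; rewrite yy // -ee.
      have yy : y = y0 + e by lia.
      have yy' : y + 1 = y0 by lia.
      by rewrite !inE => /orP[/orP[/orP[]|]|] /eqP ->; rewrite ?yy' // yy.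
    by move=> p q /all_b -> /all_b ->.
have [c allc] : exists c, forall p, chi p \in [:: b; c].
  apply: (at_most_two_colors (y0 := y0) A0 Aev (fun u v => star free row)) => x e e1.
  by apply/negPn/negP; rewrite negb_or !negbK => /andP[/eqP c1 /eqP c2];
     apply: (mono x e _ e1 erefl c1 c2).
by have [p] := three b c; rewrite allc.
Qed.
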